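(* Let $q$ be a power of an odd prime, $R=\mathbf{F}_q[T]$, $k=\mathbf{F}_q(T)$, and let $D\in R$ be a square-free monic polynomial of even degree $\deg D=2d>0$, so that $K=k(\sqrt{D})$ is a real quadratic function field. Let $P\in R$ be an irreducible polynomial splitting in $K$, and let $c\in\mathbf{F}_q^\times$. Then the ideal class number $h(D)$ of $K$ satisfies: (1) if $D=F^2+c$ with $F\in R$, then $h(D)\ge \deg F/\deg P$; (2) if $D=(SG)^2+cS$ with $S,G\in R$ and $\deg G\ge 1$, then $h(D)\ge \deg S/\deg P$.
   Context: The ring of integers $\mathcal{O}_K$ of $K$ is the integral closure of $R=\mathbf{F}_q[T]$ in $K$. The ideal class number $h(D)=h(K)$ is the order of the group of fractional ideals of $\mathcal{O}_K$ modulo principal fractional ideals. $K=k(\sqrt{D})$ is called a real quadratic function field when $D$ is monic of even degree and not a square. An irreducible $P\in R$ splits in $K$ if $P\mathcal{O}_K=\wp\overline{\wp}$ with $\wp\neq\overline{\wp}$ prime ideals of $\mathcal{O}_K$. *)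

(* Defs.v *)
From mathcomp Require Import all_boot all_order all_algebra all_field.
From mathcomp Require Import finmap.
From mathcomp Require Import boolp classical_sets functions cardinality.

Set Implicit Arguments.
Unset Strict Implicit.
Unset Printing Implicit Defensive.

Import GRing.Theory.

Local Open Scope classical_set_scope.
Local Open Scope ring_scope.

Notation ratfun Fq := {fraction {poly Fq}}.

Definition pdeg (Fq : fieldType) (A : {poly Fq}) : nat := (size A).-1.

(* A nonzero G has size 1 exactly when it is a unit of Fq[T]. *)
Definition square_free (Fq : fieldType) (D : {poly Fq}) : Prop :=
  forall G : {poly Fq}, G ^+ 2 %| D -> size G = 1%N.

Section IdealTheory.
Variables (Fq : finFieldType) (K : fieldExtType (ratfun Fq)).

Definition poly_in (A : {poly Fq}) : K := in_alg K (tofrac A).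

Definition OK : set K := [set x | integralOver poly_in x].

Definition OK_submodule (I : set K) : Prop :=
  [/\ I 0, forall x y, I x -> I y -> I (x + y)
    & forall a x, OK a -> I x -> I (a * x)].

(* Fractional ideals are required to be nonzero, as elements of a group. *)
Definition fractional_ideal (I : set K) : Prop :=
  [/\ OK_submodule I, exists2 x, I x & x != 0
    & exists r, [/\ OK r, r != 0 & forall x, I x -> OK (r * x)]].

Definition ideal_mul (I J : set K) : set K :=
  [set z | exists n (a b : 'I_n -> K),
     (forall i, I (a i) /\ J (b i)) /\ z = \sum_(i < n) a i * b i].

Definition principal (a : K) : set K := [set a * x | x in OK].

Definition prime_ideal (p : set K) : Prop :=
  [/\ OK_submodule p, p `<=` OK, ~ p 1
    & forall x y, OK x -> OK y -> p (x * y) -> p x \/ p y].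

(* The coset of I modulo the subgroup of principal fractional ideals. *)
Definition ideal_class (I : set K) : set (set K) :=
  [set J | exists2 a, a != 0 & J = ideal_mul I (principal a)].

Definition class_group : set (set (set K)) :=
  [set ideal_class I | I in [set I | fractional_ideal I]].

(* fset_set sends an infinite set to the empty one, so a positive lower bound
   on class_number implies that the class group is finite. *)
Definition class_number : nat := #|` fset_set class_group |.

(* The image of I under the conjugation a + b s |-> a - b s over Fq(T), for
   s a square root of D generating K. *)
Definition conj_ideal (s : K) (I : set K) : set K :=
  [set z | exists a b : ratfun Fq,
     I (a%:A + b%:A * s) /\ z = a%:A - b%:A * s].

Definition splits (s : K) (P : {poly Fq}) : Prop :=
  exists p : set K,
    [/\ prime_ideal p, prime_ideal (conj_ideal s p), p <> conj_ideal s p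
      & principal (poly_in P) = ideal_mul p (conj_ideal s p)].

End IdealTheory.

(* Main.v *)
(* A prime p over the split prime P satisfies p^n = (A + B s) for some
   1 <= n <= h(D), because two of the classes of p^0, ..., p^h coincide.  Taking
   norms, A^2 - D B^2 = u P^n with u a nonzero constant, and P does not divide
   both A and B, since otherwise p^n would lie in the conjugate of p.  On the other hand,
   the shape of D provides a unit of small height: F + s in case (1), and
   (S G + s)^2 / S in case (2).  If the norm form has degree < deg F, respectively
   < deg S, multiplying A + B s by this unit or its conjugate strictly decreases
   deg B, until B = 0; there P^n is a constant times a square, so P divides A, and
   this divisibility propagates back through the units.
   The class group is finite by Hurwitz's argument: division with remainder
   holds in the ring of integers up to a factor t of bounded degree, so every
   class contains an integral ideal that contains a fixed polynomial M. *)
Require Import Defs.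
From HB Require Import structures.
From mathcomp Require Import all_boot all_order all_algebra all_field.
From mathcomp Require Import finmap.
From mathcomp Require Import boolp classical_sets functions cardinality.
From mathcomp Require Import zify ring.

Set Implicit Arguments.
Unset Strict Implicit.
Unset Printing Implicit Defensive.

Import GRing.Theory Num.Theory.
Local Open Scope ring_scope.

(** * Descent on the norm form *)

(* lia does not identify the occurrences of [size A] elaborated through different
   structures; ssreflect matching does. *)
Ltac size_lia :=
  repeat match goal with
    | H : is_true (leq _ _) |- _ => revert H
    | H : @eq nat _ _ |- _ => revert H end;
  repeat match goal with
    | |- context [@size ?T ?s] =>
        let n := fresh "n" in set n := (@size T s); clearbody n end;
  clear; lia.

Lemma size_sqr (F : fieldType) (A : {poly F}) : (size (A ^+ 2) = (2 * size A).-1)%N.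
Proof.
have [->|A0] := eqVneq A 0; first by rewrite expr0n size_poly0.
by rewrite expr2 size_mul //; size_lia.
Qed.

Section Descent.
Variable F : fieldType.
Hypothesis two_neq0 : (2%:R : F) != 0.
Implicit Types A B D G S P N M : {poly F}.

Lemma irredp_dvdp_mul P A B : irreducible_poly P -> P %| A * B -> P %| A \/ P %| B.
Proof.
move=> irrP PAB; case: (boolP (P %| A)) => [|nPA]; first by left.
by right; rewrite -(Gauss_dvdpr _ (d := P) (q := A)) // irreducible_poly_coprime.
Qed.

Lemma irredp_dvdp_exp P A n : irreducible_poly P -> P %| A ^+ n -> P %| A.
Proof.
move=> irrP; elim: n => [|n IHn].
  rewrite expr0 dvdp1 => /eqP sP; have := irrP.1; by rewrite sP.
by rewrite exprS => /(irredp_dvdp_mul irrP)[].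
Qed.

(* One of the factors A - B G and A + B G is at least as large as their
   difference 2 B G, which forces the other one to be small. *)
Lemma small_factor A B G : B != 0 -> G != 0 ->
  (size (A ^+ 2 - B ^+ 2 * G ^+ 2)%R + 2 < 2 * size B + size G)%N ->
  exists b : bool, (size (B * (G * (-1) ^+ b) - A)%R < size B)%N.
Proof.
move=> B0 G0; set M := _ - _ => sM.
have sB : (0 < size B)%N by rewrite lt0n size_poly_eq0.
pose X (b : bool) := B * (G * (-1) ^+ b) - A.
have MX : M = X false * X true by rewrite /M /X /= expr0 expr1; ring.
have sBG : size (X false - X true) = (size B + size G).-1.
  have -> : X false - X true = 2%:R *: (B * G).
    by rewrite scaler_nat /X expr0 expr1; ring.
  by rewrite size_scale // size_mul.
have sX : ((size B + size G).-1 <= maxn (size (X false)) (size (X true)))%N.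
  by rewrite -sBG (leq_trans (size_polyD _ _)) // size_polyN.
suff small b : (size (X b) < size B)%N -> exists b : bool, (size (X b) < size B)%N.
  have [Xf0|Xf0] := eqVneq (X false) 0; first by apply: (small false); rewrite Xf0 size_poly0.
  have [Xt0|Xt0] := eqVneq (X true) 0; first by apply: (small true); rewrite Xt0 size_poly0.
  have sMX : size M = (size (X false) + size (X true)).-1 by rewrite MX size_mul.
  have sXf : (0 < size (X false))%N by rewrite lt0n size_poly_eq0.
  have sXt : (0 < size (X true))%N by rewrite lt0n size_poly_eq0.
  case: (leqP (size (X false)) (size (X true))) => le.
    apply: (small false); size_lia.
  apply: (small true); size_lia.
by exists b.
Qed.

(* Multiplying A + B sqrt D by the unit F +- sqrt D of norm -c shrinks B. *)
Lemma norm_descent_sqr_addC G (c : F) P n : c != 0 -> irreducible_poly P -> (0 < n)%N ->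
    (size (P ^+ n)%R < size G)%N -> forall A B (u : F), u != 0 ->
  A ^+ 2 - (G ^+ 2 + c%:P) * B ^+ 2 = u%:P * P ^+ n -> P %| A /\ P %| B.
Proof.
move=> c0 irrP n0 sPn A B; have [m] := ubnP (size B).
elim: m A B => // m IHm A B sB u u0 norm.
have [B0|B0] := eqVneq B 0.
  rewrite B0 dvdp0; split=> //; apply: (irredp_dvdp_exp (n := 2)) => //.
  move: norm; rewrite B0 expr0n mulr0 subr0 => ->.
  by rewrite -(prednK n0) exprS; apply: dvdp_mull; apply: dvdp_mulIl.
have P0 : P ^+ n != 0 by rewrite expf_neq0 // irredp_neq0.
have sP : (0 < size (P ^+ n))%N by rewrite lt0n size_poly_eq0.
have G0 : G != 0 by rewrite -size_poly_eq0 -lt0n; size_lia.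
have sB0 : (0 < size B)%N by rewrite lt0n size_poly_eq0.
have [|||b sB'] := @small_factor A B G => //.
  have -> : A ^+ 2 - B ^+ 2 * G ^+ 2 = u%:P * P ^+ n + c%:P * B ^+ 2.
    by rewrite -norm; ring.
  have := size_polyD (u%:P * P ^+ n) (c%:P * B ^+ 2).
  by rewrite !mul_polyC !size_scale // size_sqr; size_lia.
set G' := G * _ in sB'.
have GG : G' ^+ 2 = G ^+ 2 by rewrite /G' exprMn sqrr_sign mulr1.
(* [A' + B' sqrt D = (A + B sqrt D)(G' - sqrt D)], where [D = G^2 + c] and [G' = +-G] has the sign
   given by [small_factor]. The factor has norm [-c]. *)
pose A' := A * G' - B * (G ^+ 2 + c%:P).
pose B' := B * G' - A.
have sB'm : (size B' < m)%N by apply: leq_trans sB' _; rewrite -ltnS.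
have [||PA PB] := IHm A' B' sB'm (- c * u).
- by rewrite mulf_neq0 // oppr_eq0.
- rewrite polyCM polyCN -mulrA -norm /A' /B' -GG; ring.
have dvdc X : P %| c%:P * X -> P %| X by rewrite mul_polyC dvdpZr.
(* Multiplying [A' + B' sqrt D] back by [G' + sqrt D] gives [-c (A + B sqrt D)], so a common divisor
   of [A'] and [B'] divides [A] and [B]. *)
split; apply: dvdc.
  have -> : c%:P * A = - (A' * G' + B' * (G ^+ 2 + c%:P)) by rewrite /A' /B' -GG; ring.
  by rewrite dvdpNr dvdp_add // dvdp_mulr.
have -> : c%:P * B = - (B' * G' + A') by rewrite /A' /B' -GG; ring.
by rewrite dvdpNr dvdp_add // dvdp_mulr.
Qed.

(* Two successive multiplications by S G +- sqrt D, of norm -c S, followed by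
   the exact division by S, shrink B twice. *)
Lemma norm_descent_sqr_addM S G (c : F) P n : c != 0 -> irreducible_poly P -> (0 < n)%N ->
    (1 < size G)%N -> (size (P ^+ n)%R < size S)%N -> forall A B (u : F), u != 0 ->
  A ^+ 2 - ((S * G) ^+ 2 + c%:P * S) * B ^+ 2 = u%:P * P ^+ n -> P %| A /\ P %| B.
Proof.
move=> c0 irrP n0 sG sPn A B; have [m] := ubnP (size B).
elim: m A B => // m IHm A B sB u u0 norm.
have [B0|B0] := eqVneq B 0.
  rewrite B0 dvdp0; split=> //; apply: (irredp_dvdp_exp (n := 2)) => //.
  move: norm; rewrite B0 expr0n mulr0 subr0 => ->.
  by rewrite -(prednK n0) exprS; apply: dvdp_mull; apply: dvdp_mulIl.
have P0 : P ^+ n != 0 by rewrite expf_neq0 // irredp_neq0.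
have sP : (0 < size (P ^+ n))%N by rewrite lt0n size_poly_eq0.
have G0 : G != 0 by rewrite -size_poly_eq0 -lt0n; size_lia.
have S0 : S != 0 by rewrite -size_poly_eq0 -lt0n; size_lia.
have sB0 : (0 < size B)%N by rewrite lt0n size_poly_eq0.
(* Here [deg G >= 1] is essential: it makes the term [c S B^2] small enough compared with
   [B^2 S G]. *)
have [|||b sB'] := @small_factor A B (S * G) => //; first by rewrite mulf_neq0.
  have -> : A ^+ 2 - B ^+ 2 * (S * G) ^+ 2 = u%:P * P ^+ n + c%:P * (S * B ^+ 2).
    by rewrite -norm; ring.
  have := size_polyD (u%:P * P ^+ n) (c%:P * (S * B ^+ 2)).
  rewrite !mul_polyC !size_scale // (size_mul S0 (expf_neq0 2 B0)) (size_mul S0 G0) size_sqr.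
  size_lia.
rewrite -mulrA in sB'; set G' := G * _ in sB'.
have GG : G' ^+ 2 = G ^+ 2 by rewrite /G' exprMn sqrr_sign mulr1.
(* [(A + B sqrt D)(S G' - sqrt D) = S A1 + B1 sqrt D], since [S] divides [D]. In [norm1] the norm
   equation has been divided by [S]. *)
pose A1 := A * G' - B * (S * G ^+ 2 + c%:P).
pose B1 := B * (S * G') - A.
have norm1 : S * A1 ^+ 2 - (S * G ^+ 2 + c%:P) * B1 ^+ 2 = (- c * u)%:P * P ^+ n.
  apply: (mulfI S0); rewrite polyCM polyCN -mulrA mulrCA -norm /A1 /B1 exprMn -GG.
  ring.
have u1 : - c * u != 0 by rewrite mulf_neq0 // oppr_eq0.
(* Otherwise [S A1^2] would be a nonzero constant times [P^n], which has smaller degree than [S]. *)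
have B10 : B1 != 0.
  apply/eqP => B10; move: norm1; rewrite B10 expr0n mulr0 subr0 => norm1.
  have A10 : A1 != 0.
    apply/eqP => A10; move/eqP: norm1.
    by rewrite A10 expr0n mulr0 eq_sym mulf_eq0 polyC_eq0 (negPf u1) (negPf P0).
  have := congr1 (fun X : {poly F} => size X) norm1.
  by rewrite mul_polyC size_scale // (size_mul S0 (expf_neq0 2 A10)) size_sqr;
    move: A10; rewrite -size_poly_eq0; size_lia.
have sB10 : (0 < size B1)%N by rewrite lt0n size_poly_eq0.
have [|||b1 sB''] := @small_factor A1 B1 G => //.
  set M := A1 ^+ 2 - _.
  have [->|M0] := eqVneq M 0; first by rewrite size_poly0; size_lia.
  have SM : S * M = (- c * u)%:P * P ^+ n + c%:P * B1 ^+ 2.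
    by rewrite -norm1 /M; ring.
  have := size_polyD ((- c * u)%:P * P ^+ n) (c%:P * B1 ^+ 2).
  rewrite -SM !mul_polyC !size_scale // (size_mul S0 M0) size_sqr.
  move: M0; rewrite -size_poly_eq0; size_lia.
set G'' := G * _ in sB''.
have GG' : G'' ^+ 2 = G ^+ 2 by rewrite /G'' exprMn sqrr_sign mulr1.
(* [(S A1 + B1 sqrt D)(S G'' - sqrt D) = S (A2 + B2 sqrt D)]; after cancelling [S] the norm form is
   again that of [D], with value [c^2 u P^n]. *)
pose A2 := S * A1 * G'' - B1 * (S * G ^+ 2 + c%:P).
pose B2 := B1 * G'' - A1.
have sB2 : (size B2 < m)%N.
  by apply: (leq_trans sB''); apply: ltnW; apply: leq_trans sB' _; rewrite -ltnS.
have [||PA PB] := IHm A2 B2 sB2 (- c * (- c * u)).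
- by rewrite mulf_neq0 // oppr_eq0.
- rewrite polyCM -mulrA -norm1 /A2 /B2 exprMn -GG' polyCN; ring.
have dvdc X : P %| c%:P * X -> P %| X by rewrite mul_polyC dvdpZr.
have PA1 : P %| A1.
  apply: dvdc; have -> : c%:P * A1 = - (A2 * G'' + B2 * (S * G ^+ 2 + c%:P)).
    by rewrite /A2 /B2 -GG'; ring.
  by rewrite dvdpNr dvdp_add // dvdp_mulr.
have PB1 : P %| B1.
  apply: dvdc; have -> : c%:P * B1 = - (B2 * (S * G'') + A2).
    by rewrite /A2 /B2 -GG'; ring.
  by rewrite dvdpNr dvdp_add // dvdp_mulr.
split; apply: dvdc.
  have -> : c%:P * A = - (S * A1 * G' + B1 * (S * G ^+ 2 + c%:P)).
    by rewrite /A1 /B1 -GG; ring.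
  by rewrite dvdpNr dvdp_add // dvdp_mulr // dvdp_mull.
have -> : c%:P * B = - (B1 * G' + A1) by rewrite /A1 /B1 -GG; ring.
by rewrite dvdpNr dvdp_add // dvdp_mulr.
Qed.

End Descent.

(** * Fractional ideals *)

HB.instance Definition _ (Fq : finFieldType) (K : fieldExtType (ratfun Fq)) :=
  GRing.RMorphism.copy (@poly_in Fq K) (in_alg K \o @tofrac {poly Fq}).

Section Ideals.
Local Open Scope classical_set_scope.
Variables (Fq : finFieldType) (K : fieldExtType (ratfun Fq)).
Local Notation OK := (@OK Fq K).
Implicit Types (I J L : set K) (a b x y : K).

Lemma OK0 : OK 0. Proof. exact: integral0. Qed.
Lemma OK1 : OK 1. Proof. exact: integral1. Qed.
Lemma OK_add x y : OK x -> OK y -> OK (x + y). Proof. exact: integral_add. Qed.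
Lemma OK_mul x y : OK x -> OK y -> OK (x * y). Proof. exact: integral_mul. Qed.
Lemma OK_exp x n : OK x -> OK (x ^+ n).
Proof.
move=> OKx; elim: n => [|n IHn]; first exact: OK1.
by rewrite exprS; exact: OK_mul.
Qed.
Lemma OK_poly A : OK (poly_in K A). Proof. exact: integral_id. Qed.
Lemma OK_submodule_OK : OK_submodule OK.
Proof. by split; [exact: OK0 | exact: OK_add | exact: OK_mul]. Qed.

Lemma submodule_opp I x : OK_submodule I -> I x -> I (- x).
Proof.
case=> _ _ IZ Ix; rewrite -mulN1r; apply: IZ => //.
by rewrite -(rmorphN1 (@poly_in Fq K)); exact: OK_poly.
Qed.

Lemma ideal_mul_sub I J L : L 0 -> (forall x y, L x -> L y -> L (x + y)) ->
  (forall a b, I a -> J b -> L (a * b)) -> ideal_mul I J `<=` L.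
Proof.
move=> L0 LD IJL z [n [a [b [ab ->]]]]; apply: (big_ind L) => // i _.
by have [] := ab i; exact: IJL.
Qed.

Lemma ideal_mul_gen I J a b : I a -> J b -> ideal_mul I J (a * b).
Proof.
move=> Ia Jb; exists 1%N, (fun=> a), (fun=> b); split=> //.
by rewrite big_ord_recl big_ord0 addr0.
Qed.

Lemma ideal_mul0 I J : ideal_mul I J 0.
Proof. by exists 0%N, (fun=> 0), (fun=> 0); split=> [[]|]; rewrite ?big_ord0. Qed.

Lemma ideal_mul_add I J x y :
  ideal_mul I J x -> ideal_mul I J y -> ideal_mul I J (x + y).
Proof.
case=> n [a [b [ab ->]]] [m [a' [b' [ab' ->]]]].
pose glue (u : 'I_n -> K) (v : 'I_m -> K) (i : 'I_(n + m)) :=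
  match fintype.split i with inl j => u j | inr j => v j end.
exists (n + m)%N, (glue a a'), (glue b b'); split=> [i|].
  by rewrite /glue; case: fintype.split.
rewrite big_split_ord /=; congr (_ + _); apply: eq_bigr => i _; rewrite /glue.
  by rewrite (unsplitK (inl i)).
by rewrite (unsplitK (inr i)).
Qed.

Lemma ideal_mulC I J : ideal_mul I J = ideal_mul J I.
Proof.
have sub I1 J1 : ideal_mul I1 J1 `<=` ideal_mul J1 I1.
  apply: ideal_mul_sub; [exact: ideal_mul0 | exact: ideal_mul_add|].
  by move=> a b Ia Jb; rewrite mulrC; exact: ideal_mul_gen.
by apply/seteqP; split; exact: sub.
Qed.

Lemma ideal_mulA I J L : ideal_mul I (ideal_mul J L) = ideal_mul (ideal_mul I J) L.
Proof.
have sub I1 J1 L1 : ideal_mul I1 (ideal_mul J1 L1) `<=` ideal_mul (ideal_mul I1 J1) L1.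
  apply: ideal_mul_sub; [exact: ideal_mul0 | exact: ideal_mul_add|].
  move=> a z Ia; move: z.
  apply: (@ideal_mul_sub J1 L1 [set z | ideal_mul (ideal_mul I1 J1) L1 (a * z)]).
  - by rewrite /= mulr0; exact: ideal_mul0.
  - by move=> x y /= Hx Hy; rewrite mulrDr; exact: ideal_mul_add.
  - by move=> b c Jb Lc /=; rewrite mulrA; do 2?apply: ideal_mul_gen.
apply/seteqP; split; first exact: sub.
rewrite (ideal_mulC (ideal_mul I J)) (ideal_mulC I J) (ideal_mulC I) (ideal_mulC J L).
exact: sub.
Qed.

Lemma ideal_mul_submodule I J : OK_submodule I -> OK_submodule (ideal_mul I J).
Proof.
case=> I0 ID IZ; split; [exact: ideal_mul0 | exact: ideal_mul_add|].
move=> c z OKc; move: z.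
apply: (@ideal_mul_sub I J [set z | ideal_mul I J (c * z)]).
- by rewrite /= mulr0; exact: ideal_mul0.
- by move=> x y /= Hx Hy; rewrite mulrDr; exact: ideal_mul_add.
- by move=> a b Ia Jb /=; rewrite mulrA; apply: ideal_mul_gen => //; exact: IZ.
Qed.

(** Replaces products with principal ideals: [principal a] is convertible to [scale a OK], and
    scaling by a nonzero [a] can be undone. *)
Definition scale a I : set K := [set a * x | x in I].

Lemma scale_scale a b I : scale a (scale b I) = scale (a * b) I.
Proof.
apply/seteqP; split=> z.
  by case=> _ [x Ix <-] <-; exists x; rewrite ?mulrA.
by case=> x Ix <-; exists (b * x); [exists x | rewrite mulrA].
Qed.

Lemma scale1 I : scale 1 I = I.
Proof.
apply/seteqP; split=> z; first by case=> x Ix <-; rewrite mul1r.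
by exists z; rewrite ?mul1r.
Qed.

Lemma scale_inj a I J : a != 0 -> scale a I = scale a J -> I = J.
Proof.
by move=> a0 /(congr1 (scale a^-1)); rewrite !scale_scale mulVf // !scale1.
Qed.

Lemma scale_mull a I J : ideal_mul (scale a I) J = scale a (ideal_mul I J).
Proof.
apply/seteqP; split.
  apply: ideal_mul_sub.
  - by exists 0; [exact: ideal_mul0 | rewrite mulr0].
  - move=> _ _ [x Hx <-] [y Hy <-].
    by exists (x + y); [exact: ideal_mul_add | rewrite mulrDr].
  - by move=> _ b [x Ix <-] Jb; exists (x * b); [exact: ideal_mul_gen | rewrite mulrA].
move=> _ [z + <-]; move: z.
apply: (@ideal_mul_sub I J [set z | ideal_mul (scale a I) J (a * z)]).
- by rewrite /= mulr0; exact: ideal_mul0.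
- by move=> x y /= Hx Hy; rewrite mulrDr; exact: ideal_mul_add.
- by move=> b c Ib Jc /=; rewrite mulrA; apply: ideal_mul_gen => //; exists b.
Qed.

Lemma ideal_mulOK I : OK_submodule I -> ideal_mul I OK = I.
Proof.
case=> I0 ID IZ; apply/seteqP; split.
  by apply: ideal_mul_sub => // a b Ia Jb; rewrite mulrC; exact: IZ.
by move=> x Ix; rewrite -[x]mulr1; apply: ideal_mul_gen => //; exact: OK1.
Qed.

Lemma ideal_mul_principal a I : OK_submodule I -> ideal_mul I (principal a) = scale a I.
Proof.
by move=> Isub; rewrite ideal_mulC -[principal a]/(scale a OK) scale_mull ideal_mulC ideal_mulOK.
Qed.

Lemma scale_submodule a I : OK_submodule I -> OK_submodule (scale a I).
Proof. by move=> Isub; rewrite -ideal_mul_principal //; exact: ideal_mul_submodule. Qed.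

Lemma mem_ideal_class I J : OK_submodule I ->
  ideal_class I J <-> exists2 a, a != 0 & J = scale a I.
Proof.
by move=> Isub; split=> -[a a0 ->]; exists a; rewrite // ideal_mul_principal.
Qed.

Lemma ideal_class_scale a I : OK_submodule I -> a != 0 ->
  ideal_class (scale a I) = ideal_class I.
Proof.
move=> Isub a0; have aIsub := scale_submodule a Isub.
apply/seteqP; split=> J /mem_ideal_class => /(_ _)[] // b b0 ->.
  apply/mem_ideal_class => //; exists (b * a); first by rewrite mulf_neq0.
  by rewrite scale_scale.
apply/mem_ideal_class => //; exists (b / a); first by rewrite mulf_neq0 ?invr_eq0.
by rewrite scale_scale divfK.
Qed.

Definition ideal_pow I n := iter n (ideal_mul I) OK.

Lemma ideal_powS I n : ideal_pow I n.+1 = ideal_mul I (ideal_pow I n).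
Proof. by []. Qed.

Lemma ideal_pow_submodule I n : OK_submodule I -> OK_submodule (ideal_pow I n).
Proof.
by case: n => [|n] Isub; [exact: OK_submodule_OK | exact: ideal_mul_submodule].
Qed.

Lemma ideal_powD I m n : OK_submodule I ->
  ideal_pow I (m + n) = ideal_mul (ideal_pow I m) (ideal_pow I n).
Proof.
move=> Isub; elim: m => [|m IHm].
  by rewrite ideal_mulC ideal_mulOK //; exact: ideal_pow_submodule.
by rewrite addSn !ideal_powS IHm ideal_mulA.
Qed.

Lemma ideal_pow_mem I x n : I x -> ideal_pow I n (x ^+ n).
Proof.
move=> Ix; elim: n => [|n IHn]; first exact: OK1.
by rewrite exprS; exact: ideal_mul_gen.
Qed.

Lemma ideal_mul_pow I J a n : OK_submodule I -> OK_submodule J ->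
  ideal_mul I J = scale a OK -> ideal_mul (ideal_pow I n) (ideal_pow J n) = scale (a ^+ n) OK.
Proof.
move=> Isub Jsub IJ; elim: n => [|n IHn].
  by rewrite scale1 ideal_mulOK //; exact: OK_submodule_OK.
rewrite !ideal_powS -ideal_mulA (ideal_mulA _ J) (ideal_mulC _ J) -(ideal_mulA J).
rewrite ideal_mulA IJ IHn scale_mull ideal_mulC ideal_mulOK.
  by rewrite scale_scale exprS.
exact/scale_submodule/OK_submodule_OK.
Qed.

Lemma ideal_pow_subOK I n : OK_submodule I -> I `<=` OK -> ideal_pow I n `<=` OK.
Proof.
move=> Isub IOK; elim: n => [|n IHn] //; apply: ideal_mul_sub; [exact: OK0|exact: OK_add|].
by move=> a b /IOK OKa /IHn OKb; exact: OK_mul.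
Qed.

Lemma fractional_ideal_sub I : OK_submodule I -> (exists2 x, I x & x != 0) ->
  I `<=` OK -> fractional_ideal I.
Proof.
move=> Isub In0 IOK; split=> //; exists 1; split; [exact: OK1 | exact: oner_neq0|].
by move=> x Ix; rewrite mul1r; exact: IOK.
Qed.

(* If p p' is principal and two powers of p lie in the same class, then cancelling
   by powers of p' makes the intermediate power of p principal. *)
Lemma ideal_pow_principal p p' a : OK_submodule p -> OK_submodule p' ->
    p `<=` OK -> (exists2 x, p x & x != 0) -> a != 0 -> ideal_mul p p' = scale a OK ->
    finite_set (@class_group Fq K) ->
  exists n b, [/\ (0 < n)%N, (n <= class_number K)%N & ideal_pow p n = scale b OK].
Proof.
move=> psub p'sub pOK [x px x0] a0 pp' fin.
have psub_pow n := ideal_pow_submodule n psub.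
pose c (i : 'I_(class_number K).+1) := ideal_class (ideal_pow p i).
have [i [j [ij cij]]] : exists i j : 'I_(class_number K).+1, (i < j)%N /\ c i = c j.
  apply: contrapT => noij.
  have c_inj : injective c.
    move=> i j cij; apply/val_inj; case: (ltngtP i j) => // lt; case: noij.
      by exists i, j.
    by exists j, i.
  (* The exponents [0, ..., h] would give [h + 1] distinct classes. Finiteness ensures that
     [fset_set] really contains them. *)
  have : (#|` [fset c i | i in 'I_(class_number K).+1]%fset | <= class_number K)%N.
    apply: fsubset_leq_card; apply/fsubsetP => _ /imfsetP[i _ ->].
    rewrite in_fset_set // inE; exists (ideal_pow p i) => //.
    apply: fractional_ideal_sub => //; last exact: ideal_pow_subOK.
    by exists (x ^+ i); [exact: ideal_pow_mem | rewrite expf_neq0].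
  by rewrite card_imfset //= -cardE card_ord ltnn.
exists (j - i)%N.
have : ideal_class (ideal_pow p i) (ideal_pow p j).
  rewrite -[ideal_class _]/(c i) cij; apply/mem_ideal_class => //.
  by exists 1; rewrite ?oner_neq0 ?scale1.
case/mem_ideal_class => // b b0 e; exists b; split; first by rewrite subn_gt0.
  by rewrite (leq_trans (leq_subr _ _)) // -ltnS.
apply: (@scale_inj (a ^+ i)); first by rewrite expf_neq0.
have ppi := ideal_mul_pow i psub p'sub pp'.
(* From [p^j = b p^i], multiplication by [p'^i] gives [a^i p^(j-i) = (b a^i)]. *)
have := congr1 (fun X => ideal_mul X (ideal_pow p' i)) e.
rewrite scale_mull ppi -{1}(subnKC (ltnW ij)) ideal_powD // [X in ideal_mul X _]ideal_mulC.
rewrite -ideal_mulA ppi ideal_mulC scale_mull ideal_mulC ideal_mulOK // => ->.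
by rewrite !scale_scale mulrC.
Qed.

End Ideals.

(* Pigeonhole: there are more polynomials t of degree <= d than possible values
   of the top d coefficients of the remainder of t b modulo N. *)
Lemma dirichlet_approx (Fq : finFieldType) d (b N : {poly Fq}) : N != 0 ->
  exists t : {poly Fq},
    [/\ t != 0, (size t <= d.+1)%N & (size ('X^d * ((t * b) %% N))%R < size N)%N].
Proof.
move=> N0.
(* This quotient is linear in [v], has fewer than [d + 1] coefficients, and vanishes exactly when
   [X^d] times the remainder is smaller than [N]. Two vectors with the same quotient therefore
   differ by a suitable [t]. *)
pose g (v : 'rV[Fq]_d.+1) := ('X^d * ((rVpoly v * b) %% N)) %/ N.
pose f v : 'rV[Fq]_d := poly_rV (g v).
have sg v : (size (g v) <= d)%N.
  rewrite size_divp //; have := ltn_modpN0 (rVpoly v * b) N0.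
  have [->|r0] := eqVneq ((rVpoly v * b) %% N) 0; first by rewrite mulr0 size_poly0.
  have Xd0 : 'X^d != 0 :> {poly Fq} by rewrite -size_poly_eq0 size_polyXn.
  rewrite (size_mul Xd0 r0) size_polyXn; size_lia.
have /injectivePn[v [v' vv' fvv']] : ~~ injectiveb f.
  apply/negP => /injectiveP/leq_card; rewrite !card_mx !mul1n leqNgt ltn_exp2l ?ltnS ?leqnn //.
  exact: card_finNzRing_gt1.
exists (rVpoly (v - v')); split.
- apply: contraNneq vv' => /(congr1 (fun p : {poly Fq} => poly_rV p : 'rV_d.+1)).
  by rewrite /= rVpolyK linear0 => /eqP; rewrite subr_eq0.
- exact: size_poly.
have gv : g v = g v' by rewrite -(poly_rV_K (sg v)) -(poly_rV_K (sg v')) -/(f v) -/(f v') fvv'.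
have : ('X^d * ((rVpoly (v - v') * b) %% N)) %/ N == 0.
  by rewrite linearB /= mulrBl modpD modpN mulrBr divpD divpN -/(g v) -/(g v') gv subrr.
rewrite divp_eq0 (negPf N0) /= => /orP[/eqP->|//].
by rewrite size_poly0 lt0n size_poly_eq0.
Qed.

(** * The quadratic field and its class group *)

Section Quadratic.
Local Open Scope classical_set_scope.
Variables (Fq : finFieldType) (D : {poly Fq}) (d : nat) (K : fieldExtType (ratfun Fq)) (s : K).
Hypothesis two_neq0 : (2%:R : Fq) != 0.
Hypothesis D_sqfree : square_free D.
Hypothesis D_size : (1 < size D)%N.
Hypothesis D_deg : (size D <= (2 * d).+1)%N.
Hypothesis s_sqrt : s ^+ 2 = poly_in K D.
Hypothesis K_gen : <<1; s>>%VS = fullv.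
Local Notation phi := (@poly_in Fq K).
Local Notation OK := (@OK Fq K).

(** * Reduced fractions and integral closedness of the polynomial ring *)

Lemma tofrac_inj : injective (@tofrac {poly Fq}).
Proof. by move=> A B /eqP; rewrite tofrac_eq => /eqP. Qed.

Lemma poly_in_inj : injective phi.
Proof. by move=> A B /fmorph_inj /tofrac_inj. Qed.

Lemma ratfun_frac (a : ratfun Fq) :
  exists2 NM : {poly Fq} * {poly Fq}, NM.2 != 0 & a = tofrac NM.1 / tofrac NM.2.
Proof.
elim/quotW: a => x; exists (\n_x, \d_x) => /=; first exact: denom_ratioP.
apply: (canRL (mulfK _)); first by rewrite tofrac_eq0 denom_ratioP.
unlock tofrac; rewrite -[LHS]FracField.pi_mul; apply/eqmodP.
rewrite /= FracField.equivfE /FracField.mulf.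
by rewrite !numden_Ratio ?(oner_eq0, mulf_neq0, denom_ratioP) // !mulr1 mulrC.
Qed.

Lemma ratfun_coprime (a : ratfun Fq) :
  exists N M : {poly Fq}, [/\ M != 0, coprimep M N & a = tofrac N / tofrac M].
Proof.
have [[N M] /= M0 ->] := ratfun_frac a.
have g0 : gcdp M N != 0 by rewrite gcdp_eq0 negb_and M0.
have eM := divpK (dvdp_gcdl M N); have eN := divpK (dvdp_gcdr M N).
exists (N %/ gcdp M N), (M %/ gcdp M N); split.
- by apply: contraNneq M0 => e; rewrite -eM e mul0r.
- by apply: coprimep_div_gcd; rewrite M0.
rewrite -[X in tofrac X / _]eN -[X in _ / tofrac X = _]eM !rmorphM /= -mulf_div divff ?mulr1 //.
by rewrite tofrac_eq0.
Qed.

Lemma tofrac_div_const (N M : {poly Fq}) :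
  size M == 1%N -> exists A, tofrac N / tofrac M = tofrac A.
Proof.
case/size_poly1P => u u0 ->; exists (u^-1 *: N).
have uV : u^-1%:P * u%:P = 1 :> {poly Fq} by rewrite -polyCM mulVf.
have fu0 : tofrac u%:P != 0 by rewrite tofrac_eq0 polyC_eq0.
apply: (canLR (mulfK fu0)); rewrite -mul_polyC -tofracM.
by rewrite mulrAC uV mul1r.
Qed.

(** The rational root argument: clearing denominators in a monic equation for [N / M] gives
    [M %| N ^+ m], and coprimality makes [M] constant. *)
Lemma integral_ratfun (a : ratfun Fq) :
  integralOver phi a%:A -> exists A, a = tofrac A.
Proof.
case=> p p_monic; have [N [M [M0 coMN ->]]] := ratfun_coprime a.
have exprVM (L : fieldType) (t : L) i m : t != 0 -> (i <= m)%N ->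
    t^-1 ^+ i * t ^+ m = t ^+ (m - i).
  by move=> t0 im; rewrite -{1}(subnKC im) exprD exprVn mulKf ?expf_neq0.
have fM0 : tofrac M != 0 by rewrite tofrac_eq0.
have -> : map_poly phi p = map_poly (in_alg K) (map_poly (@tofrac {poly Fq}) p).
  by rewrite -map_poly_comp.
rewrite fmorph_root rootE horner_coef size_map_inj_poly ?rmorph0 //; last exact: tofrac_inj.
have := monic_neq0 p_monic; rewrite -size_poly_eq0.
have := p_monic; rewrite monicE lead_coefE.
case: (size p) => // m /eqP pm _ /eqP e.
have {}e : \sum_(i < m.+1) p`_i * N ^+ i * M ^+ (m - i) = 0.
  apply: tofrac_inj; rewrite rmorph0 rmorph_sum /=; move/(congr1 ( *%R^~ (tofrac M ^+ m))): e.
  rewrite /= mul0r mulr_suml => e; rewrite -[RHS]e.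
  apply: eq_bigr => i _; rewrite coef_map !rmorphM !rmorphXn /= expr_div_n -!mulrA.
  by congr (_ * (_ * _)); rewrite -exprVn; apply/esym/(exprVM _ _ _ _ fM0); rewrite -ltnS.
have MNm : M %| N ^+ m.
  move: e; rewrite big_ord_recr /= pm subnn mul1r mulr1 => /eqP.
  rewrite addrC addr_eq0 => /eqP->; rewrite dvdpNr.
  apply: (big_ind (fun X => M %| X)) => [|X Y|i _].
  - exact: dvdp0.
  - exact: dvdp_add.
  - by rewrite dvdp_mull // -(prednK (n := m - i)) ?subn_gt0 // exprS dvdp_mulIl.
have : size M == 1%N.
  by rewrite -dvdp1 -(Gauss_dvdpr 1 (coprimep_expr m coMN)) mulr1.
exact: tofrac_div_const.
Qed.

(** * The basis [1, s] of the field and its conjugation *)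

Lemma OK_s : OK s.
Proof.
exists ('X^2 - D%:P); last first.
  by rewrite rmorphB /= map_polyXn map_polyC rootE !hornerE s_sqrt subrr.
rewrite monicE lead_coefDl ?lead_coefXn // size_polyN size_polyXn ltnS size_polyC.
by case: (_ != _).
Qed.

(** A rational [s] would be integral, hence a polynomial [A] with [D = A^2]; square-freeness would
    then make [A], and so [D], constant. *)
Lemma s_notin_base a : s <> a%:A.
Proof.
move=> sa; have [A eA] : exists A, a = tofrac A.
  by apply: integral_ratfun; rewrite -sa; exact: OK_s.
have DA : D = A ^+ 2.
  by apply: poly_in_inj; rewrite -s_sqrt sa eA rmorphXn.
have := D_sqfree (G := A); rewrite -DA dvdpp => /(_ isT) sA.
by move: D_size sA; rewrite DA size_sqr; size_lia.
Qed.

Lemma scale1_mul (a b : ratfun Fq) : (a * b)%:A = a%:A * b%:A :> K.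
Proof. by rewrite -scalerAl mul1r scalerA. Qed.

(** Horner's scheme for a polynomial in [s]: [(a + b s) s + c = (b D + c) + a s]. *)
Lemma quad_decomp x : exists ab : ratfun Fq * ratfun Fq, x = ab.1%:A + ab.2%:A * s.
Proof.
have : x \in <<1; s>>%VS by rewrite K_gen memvf.
case/Fadjoin1_polyP => p ->; elim/poly_ind: p => [|p c [[a b] /= IHp]].
  by exists (0, 0); rewrite /= scale0r mul0r rmorph0 horner0 addr0.
exists (b * tofrac D + c, a) => /=.
rewrite rmorphD rmorphM /= map_polyX map_polyC !hornerE IHp mulrDl -mulrA -expr2 s_sqrt.
by rewrite scalerDl /poly_in in_algE -!scalerAl !mul1r scalerA [in RHS]addrC addrA.
Qed.

Lemma quad_decomp_inj a b a' b' : a%:A + b%:A * s = a'%:A + b'%:A * s -> a = a' /\ b = b'.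
Proof.
move=> e; have e' : (b - b')%:A * s = (a' - a)%:A.
  by rewrite !scalerBl mulrBl; apply: (addrI a%:A); rewrite addrA e; ring.
have [bb|bb] := eqVneq (b - b') 0.
  move: e'; rewrite bb scale0r mul0r => /eqP.
  rewrite eq_sym scaler_eq0 oner_eq0 orbF subr_eq0 => /eqP->.
  by move/eqP: bb; rewrite subr_eq0 => /eqP.
case: (@s_notin_base ((b - b')^-1 * (a' - a))).
by rewrite -in_algE rmorphM /= -e' mulrA -in_algE -rmorphM mulVf // rmorph1 mul1r.
Qed.

(** The coordinates are obtained by choice; their uniqueness, [quad_decomp_inj], makes this the
    nontrivial automorphism over the rational functions. *)
Definition conjq (x : K) : K :=
  let ab := projT1 (cid (quad_decomp x)) in ab.1%:A - ab.2%:A * s.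

Lemma conjqE a b : conjq (a%:A + b%:A * s) = a%:A - b%:A * s.
Proof.
rewrite /conjq; case: cid => -[a' b'] /= e.
by have [<- <-] := quad_decomp_inj e.
Qed.

Lemma conjq_is_zmod_morphism : zmod_morphism conjq.
Proof.
move=> x y; have [[a b] /= ->] := quad_decomp x; have [[a' b'] /= ->] := quad_decomp y.
have -> : a%:A + b%:A * s - (a'%:A + b'%:A * s) = (a - a')%:A + (b - b')%:A * s.
  by rewrite !scalerBl; ring.
by rewrite !conjqE !scalerBl; ring.
Qed.

Lemma conjq_is_monoid_morphism : monoid_morphism conjq.
Proof.
split; first by have := conjqE 1 0; rewrite scale1r scale0r mul0r addr0 subr0.
move=> x y; have [[a b] /= ->] := quad_decomp x; have [[a' b'] /= ->] := quad_decomp y.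
have -> : (a%:A + b%:A * s) * (a'%:A + b'%:A * s)
    = (a * a' + b * b' * tofrac D)%:A + (a * b' + b * a')%:A * s.
  rewrite !scalerDl !scale1_mul -[(tofrac D)%:A]/(phi D) -s_sqrt; ring.
rewrite !conjqE !scalerDl !scale1_mul -[(tofrac D)%:A]/(phi D) -s_sqrt; ring.
Qed.

HB.instance Definition _ := GRing.isZmodMorphism.Build K K conjq conjq_is_zmod_morphism.
HB.instance Definition _ := GRing.isMonoidMorphism.Build K K conjq conjq_is_monoid_morphism.

Lemma conjq_base a : conjq a%:A = a%:A.
Proof. by have := conjqE a 0; rewrite scale0r mul0r addr0 subr0. Qed.

Lemma conjq_poly A : conjq (phi A) = phi A.
Proof. exact: conjq_base. Qed.

Lemma conjq_s : conjq s = - s.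
Proof. by have := conjqE 0 1; rewrite scale0r scale1r mul1r add0r sub0r. Qed.

Lemma conjqK : involutive conjq.
Proof.
move=> x; have [[a b] /= ->] := quad_decomp x.
by rewrite conjqE rmorphB rmorphM /= !conjq_base conjq_s mulrN opprK.
Qed.

Lemma OK_conj x : OK x -> OK (conjq x).
Proof.
case=> p p_monic root_x; exists p => //.
have -> : map_poly phi p = map_poly conjq (map_poly phi p).
  by rewrite -map_poly_comp; apply: eq_map_poly => A /=; rewrite conjq_poly.
by rewrite fmorph_root.
Qed.

(** * The ring of integers and its norm form *)

Definition quad (AB : {poly Fq} * {poly Fq}) : K := phi AB.1 + phi AB.2 * s.

Lemma OKP x : OK x <-> exists AB, x = quad AB.
Proof.
have OKs := OK_s.
split=> [OKx|[AB ->]]; last first.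
  by apply: integral_add; [exact: integral_id | apply: integral_mul => //; exact: integral_id].
have OKx' := OK_conj OKx; have [[a b] /= xE] := quad_decomp x.
have two : (2%:R : ratfun Fq) != 0.
  by rewrite -(rmorph_nat (@tofrac {poly Fq})) tofrac_eq0 -(rmorph_nat (@polyC Fq)) polyC_eq0.
have half : OK (phi (2%:R^-1)%:P) by exact: integral_id.
(* [a] is half the trace of [x], and 2 is invertible. *)
have [A aA] : exists A, a = tofrac A.
  apply: integral_ratfun; have -> : a%:A = phi (2%:R^-1)%:P * (x + conjq x).
    have h2 : phi (2%:R^-1)%:P * 2%:R = 1.
      by rewrite -(rmorph_nat phi) -rmorphM -(rmorph_nat (@polyC Fq)) -polyCM mulVf // rmorph1.
    by rewrite xE conjqE -[LHS]mul1r -h2; ring.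
  by apply: integral_mul => //; apply: integral_add.
have OKbs : OK (b%:A * s).
  have -> : b%:A * s = x - phi A by rewrite xE aA /poly_in addrC addKr.
  by apply: integral_sub => //; exact: integral_id.
have [C bC] : exists C, b ^+ 2 * tofrac D = tofrac C.
  apply: integral_ratfun; have -> : (b ^+ 2 * tofrac D)%:A = (b%:A * s) * (b%:A * s).
    by rewrite mulrACA -[s * s]expr2 s_sqrt !scale1_mul.
  exact: integral_mul.
(* With [b = N / M] reduced, integrality of [b^2 D] gives [M^2 %| D], so [M] is constant by
   square-freeness. *)
have [B bB] : exists B, b = tofrac B.
  have [N [M [M0 coMN bE]]] := ratfun_coprime b.
  rewrite bE; apply: tofrac_div_const; apply/eqP; apply: D_sqfree.
  have fM0 : tofrac M != 0 by rewrite tofrac_eq0.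
  have e : N ^+ 2 * D = C * M ^+ 2.
    apply: tofrac_inj; rewrite (tofracM (N ^+ 2)) (tofracM C) !tofracXn -bC bE.
    by rewrite [in RHS]mulrAC -exprMn divfK.
  rewrite -(Gauss_dvdpr D (q := N ^+ 2)) ?e ?dvdp_mulIr //.
  exact/coprimep_expl/coprimep_expr.
by exists (A, B); rewrite xE aA bB.
Qed.

Definition qnorm (AB : {poly Fq} * {poly Fq}) := AB.1 ^+ 2 - D * AB.2 ^+ 2.

Lemma conjq_quad AB : conjq (quad AB) = phi AB.1 - phi AB.2 * s.
Proof. exact: conjqE. Qed.

Lemma quad_norm AB : phi (qnorm AB) = quad AB * conjq (quad AB).
Proof.
rewrite conjq_quad /quad /qnorm rmorphB rmorphXn rmorphM rmorphXn /= -s_sqrt; ring.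
Qed.


Lemma phi_eq0 A : (phi A == 0) = (A == 0).
Proof. by rewrite -(inj_eq (@poly_in_inj)) rmorph0. Qed.

Lemma qnorm_eq0 AB : (qnorm AB == 0) = (quad AB == 0).
Proof. by rewrite -phi_eq0 quad_norm mulf_eq0 fmorph_eq0 orbb. Qed.

Lemma OK_quad AB : OK (quad AB).
Proof. by apply/OKP; exists AB. Qed.

(** * Finiteness of the class group *)

(** As [deg D <= 2 d], the term [D r2^2] is no larger than [(X^d r2)^2]. The bound says that the
    norm is smaller than [N^2]. *)
Lemma size_qnorm_lt (N : {poly Fq}) (r : {poly Fq} * {poly Fq}) : N != 0 ->
  (size r.1 < size N)%N -> (size ('X^d * r.2)%R < size N)%N ->
  (size (qnorm r) + 1 < 2 * size N)%N.
Proof.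
case: r => r1 r2 /= N0 sr1 sr2.
have sN : (0 < size N)%N by rewrite lt0n size_poly_eq0.
have : (size (qnorm (r1, r2)) <= maxn (size (r1 ^+ 2)%R) (size (D * r2 ^+ 2)%R))%N.
  by rewrite /qnorm /= (leq_trans (size_polyD _ _)) // size_polyN.
rewrite size_sqr; have [->|r20] := eqVneq r2 0.
  by rewrite expr0n mulr0 size_poly0; size_lia.
have D0 : D != 0 by rewrite -size_poly_eq0 -lt0n (ltn_trans _ D_size).
have Xd0 : 'X^d != 0 :> {poly Fq} by rewrite -size_poly_eq0 size_polyXn.
move: sr2; rewrite (size_mul Xd0 r20) size_polyXn (size_mul D0 (expf_neq0 2 r20)) size_sqr.
have := D_deg; move: r20; rewrite -size_poly_eq0; size_lia.
Qed.

(** A common multiple of all multipliers [t] that [dirichlet_approx] can produce. *)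
Definition hurwitz : {poly Fq} :=
  \prod_(v : 'rV[Fq]_d.+1 | rVpoly v != 0) rVpoly v.

Lemma hurwitz_neq0 : hurwitz != 0.
Proof. exact/prodf_neq0. Qed.

Lemma dvd_hurwitz (t : {poly Fq}) : t != 0 -> (size t <= d.+1)%N -> t %| hurwitz.
Proof.
move=> t0 st; have tE := poly_rV_K st.
rewrite /hurwitz (bigD1 (poly_rV t)) /= tE //.
exact: dvdp_mulIl.
Qed.

(** Make the ideal integral and pick a nonzero [x] in it with norm of least degree. Every element
    [y] then satisfies [t y = w x] with [w] integral and [t] dividing [hurwitz], so scaling by
    [hurwitz / x] stays integral and sends [x] to [hurwitz]. *)
Lemma integral_representative (I : set K) : fractional_ideal I ->
  exists J : set K, [/\ OK_submodule J, J (phi hurwitz), J `<=` OK & ideal_class I = ideal_class J].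
Proof.
case=> Isub [x0 Ix0 x00] [r [OKr r0 rI]].
pose I1 := scale r I; have I1sub : OK_submodule I1 := scale_submodule r Isub.
have I1OK : I1 `<=` OK by move=> _ [x Ix <-]; exact: rI.
have OKquad := OKP.
have ex_m : exists m, `[< exists AB, [/\ I1 (quad AB), quad AB != 0 & size (qnorm AB) = m] >].
  have [|AB xE] := (OKquad (r * x0)).1; first exact: rI.
  exists (size (qnorm AB)); apply/asboolP; exists AB; split=> //.
    by rewrite -xE; exists x0.
  by rewrite -xE mulf_neq0.
case: (ex_minnP ex_m) => m /asboolP[AB [I1x x_n0 sm]] m_min.
set x := quad AB in I1x x_n0; set N := qnorm AB in sm.
have N0 : N != 0 by rewrite qnorm_eq0.
have nE : phi N = x * conjq x := quad_norm AB.
clearbody N.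
have x'0 : conjq x != 0 by rewrite fmorph_eq0.
exists (scale (phi hurwitz / x) I1); split.
- exact: scale_submodule.
- by exists x; rewrite ?divfK.
- move=> _ [y I1y <-].
  have [|[a b] yE] := (OKquad (y * conjq x)).1.
    by apply: OK_mul; [exact: I1OK | apply: OK_conj; exact: I1OK].
  (* Here [y / x = (a + b s) / N]. Only the coordinate of [s] needs approximation, because [D]
     multiplies its square in the norm; for [a] the ordinary remainder is small enough. *)
  have [t [t0 st sb]] := dirichlet_approx d b N0.
  pose w := quad ((t * a) %/ N, (t * b) %/ N).
  pose rho := ((t * a) %% N, (t * b) %% N).
  have zE : (phi t * y - w * x) * conjq x = quad rho.
    rewrite mulrBl -mulrA yE -mulrA -nE /w /rho /quad /=.
    have := congr1 phi (divp_eq (t * a) N); have := congr1 phi (divp_eq (t * b) N).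
    rewrite !rmorphD !rmorphM /= => eb ea.
    have {}ea : phi ((t * a) %% N) = phi t * phi a - phi ((t * a) %/ N) * phi N.
      by rewrite ea addrC addKr.
    have {}eb : phi ((t * b) %% N) = phi t * phi b - phi ((t * b) %/ N) * phi N.
      by rewrite eb addrC addKr.
    rewrite ea eb. ring.
  have I1z : I1 (phi t * y - w * x).
    case: (I1sub) => _ ID IZ; apply: ID; first by apply: IZ => //; exact: OK_poly.
    by apply: submodule_opp => //; apply: IZ => //; exact: OK_quad.
  have [CE zCE] := (OKquad _).1 (I1OK _ I1z).
  have z0 : phi t * y = w * x.
    apply/eqP; rewrite -subr_eq0; apply: contraT => z_n0.
    have : (m <= size (qnorm CE))%N.
      by apply: m_min; apply/asboolP; exists CE; rewrite -zCE.
    (* The norm of [rho] is smaller than [N^2], so the norm of [t y - w x] would be smaller than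
       [N], against the minimality of [x]. *)
    have nz : qnorm CE * N = qnorm rho.
      apply: (@poly_in_inj); rewrite rmorphM /= nE !quad_norm -zE -zCE rmorphM /= conjqK; ring.
    have n0 : qnorm CE != 0 by rewrite qnorm_eq0 -zCE.
    have := @size_qnorm_lt N rho N0 (ltn_modpN0 _ N0) sb.
    rewrite -nz (size_mul n0 N0) -sm.
    have : (0 < size N)%N by rewrite lt0n size_poly_eq0.
    move: n0; rewrite -size_poly_eq0; size_lia.
  have -> : phi hurwitz / x * y = phi (hurwitz %/ t) * w.
    rewrite -{1}(divpK (dvd_hurwitz t0 st)) rmorphM /= -!mulrA; congr (_ * _).
    by rewrite mulrCA z0 mulrCA mulVf ?mulr1.
  by apply: OK_mul; [exact: OK_poly | exact: OK_quad].
- rewrite !ideal_class_scale // mulf_neq0 ?invr_eq0 //.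
  by rewrite phi_eq0 hurwitz_neq0.
Qed.

(** An integral ideal containing [M] is determined by which residues modulo [M] it contains, and
    there are finitely many sets of residues. *)
Lemma finite_class_group : finite_set (@class_group Fq K).
Proof.
pose M := hurwitz.
pose T := ('rV[Fq]_(size M) * 'rV[Fq]_(size M))%type.
pose q (v : T) := quad (rVpoly v.1, rVpoly v.2).
(* [f] is applied to arbitrary sets of residues, ideals or not; it only has to reach every class. *)
pose f (X : {ffun T -> bool}) : set (set K) :=
  ideal_class [set z | exists v w, [/\ X v, OK w & z = q v + phi M * w]].
apply: (@sub_finite_set _ _ (f @` setT)); last exact/finite_image/finite_finset.
move=> _ [I /integral_representative[J [Jsub JM JOK ->]] <-].
exists [ffun v => `[< J (q v) >]] => //; congr ideal_class.
case: (Jsub) => _ JD JZ.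
apply/seteqP; split=> z.
  case=> v [w [+ OKw ->]]; rewrite ffunE => /asboolP Jv.
  by apply: JD => //; rewrite mulrC; exact: JZ.
move=> Jz; have [[A B] zE] := (OKP z).1 (JOK _ Jz).
pose w := quad (A %/ M, B %/ M).
have OKw : OK w by exact: OK_quad.
have sm C : (size (C %% M)%R <= size M)%N by rewrite ltnW // ltn_modpN0 // hurwitz_neq0.
pose v : T := (poly_rV (A %% M), poly_rV (B %% M)).
have zE' : z = q v + phi M * w.
  rewrite /q /v /= !poly_rV_K // zE /w /quad /= {1}(divp_eq A M) {1}(divp_eq B M).
  rewrite !rmorphD !rmorphM /=; ring.
exists v, w; split=> //; rewrite ffunE; apply/asboolP.
have -> : q v = z - w * phi M by rewrite zE'; ring.
by apply: JD => //; apply: submodule_opp => //; exact: JZ.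
Qed.


(** * Conjugate ideals and the norm equation of a split prime *)

Lemma quad_inj : injective quad.
Proof. by move=> [A B] [A' B'] /quad_decomp_inj[/tofrac_inj /= -> /tofrac_inj /= ->]. Qed.

Lemma poly_in_dvd A B w : OK w -> phi A * w = phi B -> A %| B.
Proof.
move=> /OKP[[W1 W2] ->] e.
have : quad (A * W1, A * W2) = quad (B, 0).
  by rewrite /quad /= rmorph0 mul0r addr0 -e /quad !rmorphM /=; ring.
by move=> /quad_inj[<- _]; exact: dvdp_mulIl.
Qed.

Lemma conj_idealP I z : conj_ideal s I z <-> I (conjq z).
Proof.
split=> [[a [b [Iab ->]]]|Iz].
  by rewrite -conjqE conjqK.
have [[a b] /= zE] := quad_decomp z; exists a, (- b).
by move: Iz; rewrite zE conjqE scaleNr mulNr opprK.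
Qed.

Lemma conj_idealK I : conj_ideal s (conj_ideal s I) = I.
Proof. by apply/seteqP; split=> z /=; rewrite !conj_idealP conjqK. Qed.

Lemma conj_ideal_sub I J : I `<=` J -> conj_ideal s I `<=` conj_ideal s J.
Proof. by move=> IJ z; rewrite !conj_idealP; exact: IJ. Qed.

Lemma conj_ideal_scaleOK a : conj_ideal s (scale a OK) = scale (conjq a) OK.
Proof.
have sub b : conj_ideal s (scale b OK) `<=` scale (conjq b) OK.
  move=> z; rewrite conj_idealP => -[x OKx e].
  by exists (conjq x); [exact: OK_conj | rewrite -rmorphM e /= conjqK].
apply/seteqP; split; first exact: sub.
rewrite -[X in X `<=` _]conj_idealK -{2}(conjqK a); apply: conj_ideal_sub; exact: sub.
Qed.

Lemma conj_ideal_mul I J :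
  conj_ideal s (ideal_mul I J) = ideal_mul (conj_ideal s I) (conj_ideal s J).
Proof.
have sub I1 J1 : ideal_mul (conj_ideal s I1) (conj_ideal s J1) `<=` conj_ideal s (ideal_mul I1 J1).
  apply: ideal_mul_sub.
  - by rewrite conj_idealP rmorph0; exact: ideal_mul0.
  - by move=> x y; rewrite !conj_idealP rmorphD; exact: ideal_mul_add.
  - by move=> a b; rewrite !conj_idealP rmorphM; exact: ideal_mul_gen.
apply/seteqP; split; last exact: sub.
rewrite -[X in _ `<=` X]conj_idealK; apply: conj_ideal_sub.
by rewrite -{1}(conj_idealK I) -{1}(conj_idealK J); exact: sub.
Qed.

Lemma conj_ideal_pow I n : conj_ideal s (ideal_pow I n) = ideal_pow (conj_ideal s I) n.
Proof.
elim: n => [|n IHn]; last by rewrite !ideal_powS conj_ideal_mul IHn.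
by have := conj_ideal_scaleOK 1; rewrite rmorph1 scale1.
Qed.

Lemma split_prime_norm_form P : irreducible_poly P -> splits s P ->
  exists n A B (u : Fq), [/\ (0 < n <= class_number K)%N, u != 0,
    A ^+ 2 - D * B ^+ 2 = u%:P * P ^+ n & ~ (P %| A /\ P %| B)].
Proof.
move=> irrP [p [[psub pOK p1 p_prime] [p'sub p'OK p'1 p'_prime] pp' Pp]].
set p' := conj_ideal s p in p'sub p'OK p'1 p'_prime pp' Pp.
have P0 : phi P != 0 by rewrite phi_eq0 irredp_neq0.
(* If [p] were zero, so would be [p p'], which contains [P]. *)
have pn0 : exists2 x, p x & x != 0.
  apply: contrapT => no.
  have : ideal_mul p p' (phi P) by rewrite -Pp; exists 1; [exact: OK1 | rewrite mulr1].
  suff sub : ideal_mul p p' `<=` [set x | x = 0] by move/sub => /eqP; rewrite (negPf P0).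
  apply: ideal_mul_sub => //= [x y -> ->|a b pa _]; first by rewrite addr0.
  have [->|a0] := eqVneq a 0; first by rewrite mul0r.
  by case: no; exists a.
have [n [a [n0 nh pn]]] :=
  ideal_pow_principal psub p'sub pOK pn0 P0 (esym Pp) finite_class_group.
have pna : ideal_pow p n a by rewrite pn; exists 1; [exact: OK1 | rewrite mulr1].
have /OKP[[A B] aE] := ideal_pow_subOK psub pOK pna.
(* Both sides equal [p^n p'^n]: the left one from [p p' = (P)], the right one from [p^n = (a)] and
   its conjugate. *)
have normP : scale (phi P ^+ n) OK = scale (phi (qnorm (A, B))) OK.
  rewrite quad_norm -aE -(ideal_mul_pow n psub p'sub (esym Pp)) -conj_ideal_pow pn.
  rewrite conj_ideal_scaleOK scale_mull ideal_mulC ideal_mulOK ?scale_scale //.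
  exact/scale_submodule/OK_submodule_OK.
rewrite -rmorphXn /= in normP.
have scale_dvd X Y : scale (phi X) OK (phi Y) -> X %| Y.
  by case=> w OKw; exact: poly_in_dvd.
have mem_scale X : scale (phi X) OK (phi X).
  by exists 1; [exact: OK1 | rewrite mulr1].
have : qnorm (A, B) %= P ^+ n.
  by apply/andP; split; apply: scale_dvd; [rewrite -normP | rewrite normP].
case/eqpf_eq => u u0 nE; exists n, A, B, u; split=> //; rewrite ?n0 //.
  by rewrite mul_polyC -nE.
case=> /dvdpP[A1 A1E] /dvdpP[B1 B1E].
(* If [P] divides [A] and [B], then [a] lies in [(P) = p p'], hence in [p']. Primality of [p'] then
   gives [p] inside [p'], and conjugation gives the reverse inclusion. *)
have pnp' : ideal_pow p n `<=` p'.
  rewrite pn => _ [x OKx <-]; case: (p'sub) => _ _ p'Z; rewrite mulrC; apply: p'Z => //.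
  have : ideal_mul p p' a.
    rewrite -Pp; exists (quad (A1, B1)); first exact: OK_quad.
    by rewrite aE A1E B1E /quad /= !rmorphM /=; ring.
  have sub : ideal_mul p p' `<=` p'.
    case: p'sub => p'0 p'D p'Z'; apply: ideal_mul_sub => // b c /pOK OKb; exact: p'Z'.
  exact: sub.
have p'pow x m : OK x -> p' (x ^+ m.+1) -> p' x.
  move=> OKx; elim: m => [|m IHm] //; rewrite exprS => p'xx.
  by case: (p'_prime _ _ OKx (OK_exp m.+1 OKx) p'xx).
have sub : p `<=` p'.
  move=> x px; apply: (p'pow x n.-1); first exact: pOK.
  by rewrite prednK //; apply: pnp'; exact: ideal_pow_mem.
apply: pp'; apply/seteqP; split => //.
by rewrite -[X in _ `<=` X]conj_idealK; exact: conj_ideal_sub.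
Qed.

End Quadratic.

(** * The class number bounds *)

Theorem theorem2
  (p e : nat) (p_prime : prime p) (p_odd : odd p) (e_gt0 : (0 < e)%N)
  (Fq : finFieldType) (card_Fq : #|Fq| = (p ^ e)%N)
  (D : {poly Fq}) (d : nat)
  (D_monic : D \is monic) (D_sqfree : square_free D)
  (d_gt0 : (0 < d)%N) (D_deg : pdeg D = (2 * d)%N)
  (K : fieldExtType (ratfun Fq)) (s : K)
  (s_sqrt : s ^+ 2 = poly_in K D) (K_gen : <<1; s>>%VS = fullv)
  (P : {poly Fq}) (P_irr : irreducible_poly P) (P_splits : splits s P)
  (c : Fq) (c_neq0 : c != 0) :
  (forall F : {poly Fq},
     D = F ^+ 2 + c%:P ->
     (pdeg F)%:R / (pdeg P)%:R <= (class_number K)%:R :> rat)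
  /\
  (forall S G : {poly Fq},
     D = (S * G) ^+ 2 + c%:P * S -> (1 <= pdeg G)%N ->
     (pdeg S)%:R / (pdeg P)%:R <= (class_number K)%:R :> rat).
Proof.
have two_neq0 : (2%:R : Fq) != 0.
  have char_p := card_finPcharP card_Fq p_prime.
  rewrite -(dvdn_pcharf char_p); apply/negP => /(@dvdn_leq _ 2 isT) p_le2.
  by have := prime_gt1 p_prime; case: (p) p_odd p_le2 => [|[|[]]].
have sD : size D = (2 * d).+1 by rewrite -D_deg prednK // lt0n size_poly_eq0 monic_neq0.
have D_size : (1 < size D)%N by rewrite sD; lia.
have D_le : (size D <= (2 * d).+1)%N by rewrite sD.
have [n [A [B [u [n_bound u0 nE PAB]]]]] :=
  split_prime_norm_form two_neq0 D_sqfree D_size D_le s_sqrt K_gen P_irr P_splits.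
case/andP: n_bound => n0 nh.
have P0 : (0 < pdeg P)%N by rewrite /pdeg -subn1 subn_gt0 P_irr.1.
(* Used with [X] equal to [F] or [S]: if [h deg P < deg X], then [n <= h] makes [P^n] smaller than
   [X], and the descent forces [P] to divide both [A] and [B]. *)
have bound (X : {poly Fq}) : ((size (P ^+ n)%R < size X)%N -> False) ->
    (pdeg X)%:R / (pdeg P)%:R <= (class_number K)%:R :> rat.
  move=> noX; rewrite ler_pdivrMr ?ltr0n // -natrM ler_nat leqNgt.
  apply/negP => lt_h; apply: noX.
  have := size_exp P n; rewrite -/(pdeg P) => sPn.
  have : (pdeg P * n < pdeg X)%N.
    by rewrite (leq_ltn_trans _ lt_h) // mulnC leq_mul2r nh orbT.
  rewrite -sPn /pdeg; size_lia.
split=> [F DE|S G DE G1]; apply: bound => sP; apply: PAB; rewrite DE in nE.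
  exact: (norm_descent_sqr_addC two_neq0 c_neq0 P_irr n0 sP u0 nE).
have sG : (1 < size G)%N by move: G1; rewrite /pdeg; size_lia.
exact: (norm_descent_sqr_addM two_neq0 c_neq0 P_irr n0 sG sP u0 nE).
Qed.
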